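(* Let $M$ be a smooth surface, $h:M\to M$ a $C^2$ diffeomorphism, $x_0,\dots,x_{n-1}\in M$ points, and $\{\phi_i:V_i\to M\}_{0\le i<n}$ a set of $C^2$ charts (with $V_i\subset\mathbb{R}^2$ open, $0\in V_i$) such that $x_i=\phi_i(0)$. Assume $h(x_i)\in \phi_{i+1\bmod n}(V_{i+1\bmod n})$ for all $0\le i<n$. For each such $i$, set $$U_i=\{v\in V_i \mid h(\phi_i(v))\in\phi_{i+1\bmod n}(V_{i+1\bmod n})\},\qquad h_i^c=\phi_{i+1\bmod n}^{-1}\circ h\circ\phi_i:U_i\to\mathbb{R}^2,\qquad L_i=(Dh_i^c)_0 .$$ Define the linear map $L:\mathbb{R}^{2n}\to\mathbb{R}^{2n}$ by $$L(w_0,\dots,w_{n-1})=(L_{n-1}w_{n-1},L_0w_0,L_1w_1,\dots,L_{n-2}w_{n-2}),\qquad w_i\in\mathbb{R}^2 .$$ Assume $L-I_{2n}$ is invertible (equivalently, $L_{n-1}L_{n-2}\cdots L_0-I_2$ is invertible), and let $\kappa=\|(L-I_{2n})^{-1}\|_{op,0}$. If there exists $\delta>0$ such that (1) for all $i$, $B_{12\kappa\delta}(0)\subset U_i$; (2) for all $i$, $$12\kappa\delta<\frac1\kappa\cdot\frac{1}{16\,\|D^2h_i^c\|_{C^0(B_{12\kappa\delta}(0)),\infty}};$$ (3) for all $i$, $\|h_i^c(0)\|_2<\delta$; then there exists an $h$-periodic point $p\in M$ satisfying $h^n(p)=p$ and $h^i(p)\in\phi_i(B_{6\kappa\delta}(0))$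 for all $0\le i<n$.
   Context: $\|\cdot\|_2$ is the Euclidean norm and $B_r(0)\subset\mathbb{R}^2$ is the Euclidean ball of radius $r$ about $0$. $\|\cdot\|_0$ is the norm on $(\mathbb{R}^2)^n$ given by $\|(v_1,\dots,v_n)\|_0=\max_{i}\|v_i\|_2$, and for a $2n\times 2n$ real matrix $N$, $\|N\|_{op,0}$ is its operator norm as a map $((\mathbb{R}^2)^n,\|\cdot\|_0)\to((\mathbb{R}^2)^n,\|\cdot\|_0)$. For a $C^2$ map $g=(g_1,g_2)$ on an open set containing $U\subset\mathbb{R}^2$, $\|D^2g\|_{C^0(U),\infty}$ is the supremum over $x\in U$ of the maximum absolute value of the entries of the Hessian matrices of $g_1$ and $g_2$ at $x$ (i.e. of all second-order partial derivatives of the components). *)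

(* Defs.v *)
From HB Require Import structures.
From mathcomp Require Import all_boot all_order all_algebra.
From mathcomp Require Import all_classical all_reals all_analysis.
Set Implicit Arguments.
Unset Strict Implicit.
Unset Printing Implicit Defensive.
Import Order.TTheory GRing.Theory Num.Theory.
Import numFieldNormedType.Exports.
Local Open Scope classical_set_scope.
Local Open Scope ring_scope.

Section EuclideanPlane.
Context {R : realType}.
(* ['rV[R]_2] carries the sup norm in the library; it induces the usual
   topology and differentials, but the Euclidean norm has to be defined. *)
Local Notation plane := 'rV[R]_2.

Definition enorm (v : plane) : R := Num.sqrt (\sum_(j < 2) v 0 j ^+ 2).

Definition eball (r : R) : set plane := [set v | enorm v < r].

Definition partial (a : 'I_2) (g : plane -> plane) : plane -> plane :=
  'D_(delta_mx 0 a) g.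

(* Only meaningful for [U] open. *)
Fixpoint Ck (k : nat) (U : set plane) (g : plane -> plane) : Prop :=
  (forall v, U v -> {for v, continuous g}) /\
  if k is k'.+1 then
    forall a, (forall v, U v -> derivable g v (delta_mx 0 a)) /\
              Ck k' U (partial a g)
  else True.

(* [hessian g c v] is the Hessian matrix at [v] of the component [c] of [g]. *)
Definition hessian (g : plane -> plane) (c : 'I_2) (v : plane) : 'M[R]_2 :=
  \matrix_(a, b) 'D_(delta_mx 0 a) ('D_(delta_mx 0 b) (fun u => g u 0 c)) v.

(* The supremum is taken in the extended reals since the second derivatives
   need not be bounded on [U]. *)
Definition D2norm (U : set plane) (g : plane -> plane) : \bar R :=
  ereal_sup [set (\big[Num.max/0]_(c < 2) \big[Num.max/0]_(a < 2)
                    \big[Num.max/0]_(b < 2) `|hessian g c v a b|)%:E | v in U].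

(* An element (v_0, ..., v_(n-1)) of (R^2)^n is the n x 2 matrix with rows
   v_i. *)
Definition norm0 (n : nat) (v : 'M[R]_(n, 2)) : R :=
  \big[Num.max/0]_(i < n) enorm (row i v).

(* [mxvec] identifies (R^2)^n with R^(2n); as everywhere in the library,
   matrices act on row vectors from the right. *)
Definition opnorm0 (n : nat) (N : 'M[R]_(n * 2)) : R :=
  sup [set norm0 (vec_mx (mxvec v *m N)) | v in [set v | norm0 v <= 1]].

(* (w_0, ..., w_(n-1)) |-> (l_(n-1) w_(n-1), l_0 w_0, ..., l_(n-2) w_(n-2)) *)
Definition cyclic_map (n : nat) (l : 'I_n -> plane -> plane)
    (w : 'M[R]_(n, 2)) : 'M[R]_(n, 2) :=
  \matrix_(i < n) l (ord_pred i) (row (ord_pred i) w).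

End EuclideanPlane.

(* A local parametrization phi : V -> M, V a subset of R^2. The value of
   [pfun] outside [pdom] is irrelevant. *)
Record param (R : realType) (M : Type) := Param {
  pdom : set 'rV[R]_2;
  pfun :> 'rV[R]_2 -> M }.

Section Params.
Context {R : realType}.
Local Notation plane := 'rV[R]_2.

Definition pimage (M : Type) (c : param R M) : set M := c @` pdom c.

(* Inverse of [c] on [pimage c], with value 0 elsewhere. *)
Definition pcoord (M : Type) (c : param R M) : M -> plane :=
  'pinv_(fun=> 0) (pdom c) c.

(* [c] is a homeomorphism from an open subset of the plane onto an open
   subset of [M]. *)
Definition topological_chart (M : topologicalType) (c : param R M) : Prop :=
  [/\ open (pdom c),
      {in pdom c &, injective c},
      (forall v, pdom c v -> {for v, continuous c}) &
      (forall W, open W -> W `<=` pdom c -> open (c @` W))].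

(* The expression c'^-1 o f o c of [f] in local coordinates, and its domain. *)
Definition locdom (M N : Type) (f : M -> N) (c : param R M) (c' : param R N) :
  set plane := [set v | pdom c v /\ pimage c' (f (c v))].

Definition locrep (M N : Type) (f : M -> N) (c : param R M) (c' : param R N) :
  plane -> plane := fun v => pcoord c' (f (c v)).

Definition Ck_transition (M : Type) (k : nat) (c c' : param R M) : Prop :=
  Ck k (locdom id c c') (locrep id c c').

End Params.

(* The smooth structure is given by an atlas that need not be maximal. *)
Record smoothSurface (R : realType) := SmoothSurface {
  scarrier :> topologicalType;
  atlas : set (param R scarrier);
  surface_hausdorff : hausdorff_space scarrier;
  surface_second_countable : @second_countable scarrier;
  atlas_chart : forall c, atlas c -> topological_chart c;
  atlas_cover : forall p, exists2 c, atlas c & pimage c p;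
  atlas_smooth : forall c c' k, atlas c -> atlas c' -> Ck_transition k c c' }.

Section Surfaces.
Context {R : realType}.

(* A C^k chart of [M] : a topological chart that is C^k-compatible with the
   smooth structure. *)
Definition Ck_chart (k : nat) (M : smoothSurface R) (c : param R M) : Prop :=
  topological_chart c /\
  forall c', atlas c' -> Ck_transition k c c' /\ Ck_transition k c' c.

Definition Ck_map (k : nat) (M N : smoothSurface R) (f : M -> N) : Prop :=
  continuous f /\
  forall c c', atlas c -> atlas c' -> Ck k (locdom f c c') (locrep f c c').

Definition Ck_diffeo (k : nat) (M N : smoothSurface R) (f : M -> N) : Prop :=
  exists g : N -> M, [/\ cancel f g, cancel g f, Ck_map k f & Ck_map k g].

End Surfaces.

(* Main.v *)
Require Import Defs.
From HB Require Import structures.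
From mathcomp Require Import all_boot all_order all_algebra.
From mathcomp Require Import all_classical all_reals all_analysis.
From mathcomp Require Import ring lra.
Set Implicit Arguments.
Unset Strict Implicit.
Unset Printing Implicit Defensive.
Import Order.TTheory GRing.Theory Num.Theory.
Import numFieldNormedType.Exports.
Local Open Scope classical_set_scope.
Local Open Scope ring_scope.

(** The points of a periodic orbit that shadows x_0, ..., x_(n-1), read in the
    charts phi_i, are the solutions w = (w_0, ..., w_(n-1)) of F w = w, where F
    is the cyclic map with components h_i^c. Write L for the cyclic map of the
    differentials of the h_i^c at 0. Then F w = w if and only if w is a fixed
    point of the simplified Newton map
      G w = (L - I)^-1 (L w - F w),
    and Banach's theorem applies to G on the ball of radius
    rho = 2 kappa delta.

    The estimates use the sup norm |.| of all the coordinates, for which the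
    matrix space is complete, and ||.||_0 only to bring in kappa; they are
    related by |w| <= ||w||_0 <= 2 |w|. Let r = 12 kappa delta and let C bound
    the second partial derivatives of h_i^c on the ball of radius r. The mean value
    inequality along broken lines parallel to the axes, applied to the first
    partial derivatives and then to h_i^c - L_i, bounds the increments of
    h_i^c - L_i on the box |v| <= rho by 8 C rho |v - u|
    (linearization_error_le). As 16 kappa r C < 1 (D2norm_bound), this makes G
    a 1/12-contraction of the ball |w| <= rho, and |G 0| <= kappa delta gives
    its invariance (cyclic_fixed_point). The fixed point satisfies
    ||w||_0 <= 2 rho = 4 kappa delta < 6 kappa delta.

    These estimates use the differential of h_i^c at 0 and the second partial
    derivatives. The regularity of h and of phi_i is given in the charts of the
    atlas, so that h_i^c is locally a composite of three maps with continuous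
    second partial derivatives. A map with continuous partial derivatives is
    differentiable (differentiable_from_partials), so the three maps and their
    first partial derivatives are differentiable. This property is local and,
    by the chain rule, stable under composition; hence h_i^c has it
    (Ck_map_locrep). *)

(** * Mean value inequalities *)

Section MeanValue.
Context {R : realType}.
Implicit Types (x u v : 'rV[R]_2) (f : 'rV[R]_2 -> R).

Lemma row2P u v : u 0 0 = v 0 0 -> u 0 1 = v 0 1 -> u = v.
Proof.
move=> h0 h1; apply/rowP => j.
have /orP[/eqP->//|/eqP->//] : (j == 0) || (j == 1) by case: j => [[|[|]]].
Qed.

Lemma mx_norm_le (m n : nat) (A : 'M[R]_(m, n)) (r : R) : 0 <= r ->
  (`|A| <= r) <-> (forall i j, `|A i j| <= r).
Proof.
move=> r0; rewrite [`|A|]/Num.Def.normr/= mx_normrE; split.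
  by move=> /bigmax_leP[_ H] i j; exact: (H (i, j)).
by move=> H; apply/bigmax_leP; split => // -[i j] _; exact: H.
Qed.

Lemma mx_entry_le_norm (m n : nat) (A : 'M[R]_(m, n)) i j : `|A i j| <= `|A|.
Proof. by move: i j; apply/mx_norm_le. Qed.

Lemma is_derive_line (V : normedModType R) (f : V -> R) (u w : V) (r : R) :
  derivable f (u + r *: w) w ->
  is_derive r 1 (fun s : R => f (u + s *: w)) ('D_w f (u + r *: w)).
Proof.
have E : (fun h : R => h^-1 *: (((fun s : R => f (u + s *: w)) \o shift r)
            (h *: (1 : R)) - f (u + r *: w))) =
         (fun h => h^-1 *: ((f \o shift (u + r *: w)) (h *: w)
            - f (u + r *: w))).
  rewrite funeqE => h /=; congr (_ *: (f _ - _)).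
  by rewrite [h *: 1]mulr1 scalerDl addrCA.
move=> df; split; first by move: df; rewrite /derivable E.
by rewrite /derive E.
Qed.

(** [t] may be negative: the segment is parametrized by [s * t] with
    [0 <= s <= 1]. *)
Lemma line_increment_le (V : normedModType R) (f : V -> R) (u w : V) (t K : R) :
  (forall s, 0 <= s <= 1 -> derivable f (u + (s * t) *: w) w /\
     `|'D_w f (u + (s * t) *: w)| <= K) ->
  `|f (u + t *: w) - f u| <= K * `|t|.
Proof.
wlog t0 : u t / 0 <= t => [hwlog H|H].
  have [/hwlog|t0] := leP 0 t; first exact.
  have := hwlog (u + t *: w) (- t); rewrite normrN distrC.
  rewrite scaleNr addrK; apply; first by rewrite oppr_ge0 ltW.
  move=> s s01; have := H (1 - s).
  have -> : u + ((1 - s) * t) *: w = u + t *: w + (s * - t) *: w.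
    by rewrite -addrA -scalerDl; congr (_ + _ *: _); ring.
  by apply; lra.
have [->|tn0] := eqVneq t 0.
  by rewrite scale0r addr0 subrr !normr0 mulr0.
have tp : 0 < t by rewrite lt_def tn0.
have D r : 0 <= r <= t -> derivable f (u + r *: w) w /\
     `|'D_w f (u + r *: w)| <= K.
  move=> /andP[r0 rt]; have := H (r / t); rewrite divfK //; apply.
  by rewrite divr_ge0 //= ler_pdivrMr // mul1r.
have Df r : 0 <= r <= t ->
    is_derive r 1 (fun s : R => f (u + s *: w)) ('D_w f (u + r *: w)).
  by move=> /D[/is_derive_line].
have [||c ct] := @MVT_segment R (fun s => f (u + s *: w))
    (fun s => 'D_w f (u + s *: w)) 0 t t0.
- move=> r; rewrite in_itv /= => /andP[r0 rt]; apply: Df.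
  by rewrite !ltW.
- apply: derivable_within_continuous => r; rewrite in_itv /= => /Df[].
  by [].
rewrite scale0r addr0 subr0 => ->.
rewrite normrM ler_wpM2r //.
by case: (D c) => //; move: ct; rewrite in_itv.
Qed.

(** The increment from [u] to [v] is split at the corner with first coordinate
    that of [v] and second coordinate that of [u]; both segments stay in the
    box, i.e. in the closed ball of the sup norm, so that only partial
    derivatives are involved and no differentiability is assumed. *)
Lemma box_increment_le f x u v (rho K : R) :
  `|u - x| <= rho -> `|v - x| <= rho ->
  (forall z, `|z - x| <= rho -> forall a, derivable f z (delta_mx 0 a) /\
      `|'D_(delta_mx 0 a) f z| <= K) ->
  `|f v - f u| <= K * (`|v 0 0 - u 0 0| + `|v 0 1 - u 0 1|).
Proof.
move=> ux vx H; have rho0 : 0 <= rho := le_trans (normr_ge0 _) ux.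
have /(mx_norm_le _ rho0) ux' := ux; have /(mx_norm_le _ rho0) vx' := vx.
have [/andP[u0l u0r] /andP[u1l u1r] /andP[v0l v0r] /andP[v1l v1r]] :
    [/\ - rho <= u 0 0 - x 0 0 <= rho, - rho <= u 0 1 - x 0 1 <= rho,
        - rho <= v 0 0 - x 0 0 <= rho & - rho <= v 0 1 - x 0 1 <= rho].
  have := ux' 0 0; have := ux' 0 1; have := vx' 0 0; have := vx' 0 1.
  by rewrite !mxE !ler_norml.
have box (z : 'rV[R]_2) : `|z 0 0 - x 0 0| <= rho -> `|z 0 1 - x 0 1| <= rho ->
    `|z - x| <= rho.
  move=> z0 z1; apply/mx_norm_le => // i j; rewrite ord1 !mxE.
  by have /orP[/eqP->//|/eqP->//] : (j == 0) || (j == 1) by case: j => [[|[|]]].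
(* w is the corner of the broken line *)
pose w := u + (v 0 0 - u 0 0) *: delta_mx 0 0.
have vE : v = w + (v 0 1 - u 0 1) *: delta_mx 0 1.
  by apply: row2P; rewrite !mxE /=; ring.
have -> : f v - f u = (f v - f w) + (f w - f u) by rewrite subrKA.
apply: (le_trans (ler_normD _ _)); rewrite addrC mulrDr.
rewrite lerD //; last first.
  rewrite [X in f X - _]vE; apply: line_increment_le => s /andP[s0 s1].
  apply: H; apply: box; rewrite !mxE /= ler_norml; nra.
apply: line_increment_le => s /andP[s0 s1].
by apply: H; apply: box; rewrite !mxE /= ler_norml; nra.
Qed.

End MeanValue.

(** * Differentiability from continuous partial derivatives *)

Section Differentiability.
Context {R : realType}.
Local Notation plane := 'rV[R]_2.

Lemma near_eq_differentiable (V W : normedModType R) (f g : V -> W) (x : V) :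
  {near x, f =1 g} -> differentiable f x -> differentiable g x.
Proof.
move=> fg df; have dfc := diff_continuous df.
have fgx : f x = g x := nbhs_singleton fg.
suff H : g \o shift x = cst (g x) + 'd f x +o_ 0 id.
  by apply/diff_locallyP; rewrite (diff_unique dfc H).
apply/eqaddoP => e e0.
have /eqaddoP/(_ _ e0) := diff_locally df.
have fg0 : \forall h \near 0, f (h + x) = g (h + x).
  by move: fg; rewrite (near_shift 0) subr0.
apply: filterS2 fg0 => h /= E.
by rewrite !fctE /= E fgx.
Qed.

Lemma differentiable_from_partials_scalar (f : plane -> R) (x : plane) :
  (\forall z \near x, forall a, derivable f z (delta_mx 0 a)) ->
  (forall a, {for x, continuous ('D_(delta_mx 0 a) f)}) ->
  differentiable f x.
Proof.
move=> fD fC.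
pose c (a : 'I_2) := 'D_(delta_mx 0 a) f x.
pose df (v : plane) := v 0 0 * c 0 + v 0 1 * c 1.
have df_lin : linear df.
  by move=> k u v; rewrite /df !mxE -[k *: _]/(k * _); ring.
pose dfM := GRing.isLinear.Build _ _ _ _ _ df_lin.
pose dfL : {linear plane -> R} := HB.pack df dfM.
have df_cont : continuous dfL.
  move=> v; apply: differentiable_continuous.
  by apply: differentiableD; apply: differentiableM => //;
    exact: differentiable_coord.
suff H : f \o shift x = cst (f x) + dfL +o_ (0 : plane) id.
  by apply/diff_locallyP; rewrite (diff_unique df_cont H).
apply/eqaddoP => e e0.
have e20 : 0 < e / 2 by rewrite divr_gt0.
have small : \forall z \near x, forall a, derivable f z (delta_mx 0 a) /\
    `|'D_(delta_mx 0 a) f z - c a| <= e / 2.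
  near=> z => a; split; first by move: a; near: z.
  move: a; near: z; apply: filter_forall => a.
  have /cvgrPdist_le/(_ _ e20) := fC a.
  by apply: filterS => z; rewrite distrC.
move/nbhs_ballP: small => [rho /= rho0 small].
have hnear : \forall h \near (0 : plane), `|h| < rho.
  by apply/nbhs_ballP; exists rho => //= z; rewrite -ball_normE /= sub0r normrN.
near=> h.
have hr : `|h| < rho by near: h; exact: hnear.
rewrite !fctE /=.
(* f minus its candidate differential has small partial derivatives *)
pose g (z : plane) := f z - dfL z.
have dg z : `|z - x| <= `|h| -> forall a, derivable g z (delta_mx 0 a) /\
    `|'D_(delta_mx 0 a) g z| <= e / 2.
  move=> zx a.
  have /small/(_ a)[fz fzle] : ball x rho z.
    by rewrite -ball_normE /= distrC (le_lt_trans zx).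
  have ddf : is_derive z (delta_mx 0 a : plane) dfL (c a).
    have dd : differentiable dfL z by exact: linear_differentiable.
    split; first exact: diff_derivable.
    rewrite deriveE // diff_lin // /dfL /= /df !mxE /=.
    have /orP[/eqP->|/eqP->] : (a == 0) || (a == 1).
      by case: (a) => [[|[|]]].
    - by rewrite eqxx /= mul1r mul0r addr0.
    - by rewrite eqxx /= mul1r mul0r add0r.
  split; first exact: derivableB.
  by rewrite deriveB // derive_val.
have := @box_increment_le R g x x (h + x) `|h| (e / 2).
rewrite subrr normr0 addrK lexx => /(_ (normr_ge0 _) isT dg).
rewrite /g !mxE /= !addrK => H.
have -> : (f (h + x) - (f x + df h)) = (f (h + x) - df (h + x)) - (f x - df x).
  rewrite /df !mxE; ring.
apply: (le_trans H).
have h0 := mx_entry_le_norm h 0 0; have h1 := mx_entry_le_norm h 0 1.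
by nra.
Unshelve. all: by end_near. Qed.
End Differentiability.
(** * Twice differentiable maps of the plane *)

Section TwiceDifferentiable.
Context {R : realType}.
Local Notation plane := 'rV[R]_2.
Implicit Types (f g : plane -> plane) (U V : set plane).

(** On an open set, [g] and its first partial derivatives are differentiable in
    the sense of Frechet. The second derivatives are not required to be
    continuous, so that stability under composition follows from the rules for
    first derivatives. *)
Definition twice_differentiable U g :=
  (forall v, U v -> differentiable g v) /\
  (forall a v, U v -> differentiable (partial a g) v).

Lemma row2_decomp (v : plane) :
  v = v 0 0 *: delta_mx 0 0 + v 0 1 *: delta_mx 0 1.
Proof. by apply: row2P; rewrite !mxE /=; ring. Qed.

Lemma linear_row2 (G : {linear plane -> plane}) (w : plane) :
  G w = w 0 0 *: G (delta_mx 0 0) + w 0 1 *: G (delta_mx 0 1).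
Proof. by rewrite {1}(row2_decomp w) linearD !linearZ. Qed.

Lemma differentiable_row (g : plane -> plane) (x : plane) :
  (forall j, differentiable (fun v => g v 0 j) x) -> differentiable g x.
Proof.
move=> dg.
have -> : g = (fun v => g v 0 0 *: (delta_mx 0 0 : plane)) +
              (fun v => g v 0 1 *: (delta_mx 0 1 : plane)).
  by rewrite funeqE => v; rewrite [LHS]row2_decomp.
by apply: differentiableD; apply: differentiableZl; exact: dg.
Qed.

Lemma differentiable_coordinate f x j : differentiable f x ->
  differentiable (fun v => f v 0 j) x.
Proof.
move=> df.
exact: (@differentiable_comp _ _ _ _ f (fun v : plane => v 0 j) x df
  (differentiable_coord _ _ _)).
Qed.

Lemma differentiable_scale (k : plane -> R) f x :
  differentiable k x -> differentiable f x ->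
  differentiable (fun z => k z *: f z) x.
Proof.
move=> dk df; apply: differentiable_row => j.
have -> : (fun z => (k z *: f z) 0 j) = k * (fun z => f z 0 j).
  by rewrite funeqE => z; rewrite mxE.
by apply: differentiableM => //; exact: differentiable_coordinate.
Qed.

Lemma derive_coordinate f x (w : plane) j : derivable f x w ->
  'D_w (fun v => f v 0 j) x = ('D_w f x) 0 j.
Proof. by move=> df; rewrite [in RHS]derive_mx // mxE. Qed.

Lemma differentiable_from_partials f U : open U ->
  (forall a v, U v -> derivable f v (delta_mx 0 a)) ->
  (forall a v, U v -> {for v, continuous (partial a f)}) ->
  forall v, U v -> differentiable f v.
Proof.
move=> oU Df Cf v Uv; have nU : nbhs v U by exact: open_nbhs_nbhs.
apply: differentiable_row => j; apply: differentiable_from_partials_scalar.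
  by apply: filterS nU => z /= Uz a; have /derivable_mxP := Df a z Uz; exact.
move=> a.
have E : {near v, (fun z => partial a f z 0 j) =1
                  'D_(delta_mx 0 a) (fun u => f u 0 j)}.
  by apply: filterS nU => z /= Uz; rewrite derive_coordinate //; exact: Df.
have Cj : {for v, continuous (fun z => partial a f z 0 j)}.
  apply: (@continuous_comp _ _ _ (partial a f) (fun u : plane => u 0 j)).
    exact: Cf.
  exact: (@coord_continuous R 1 2 0 j (partial a f v)).
have Ev := nbhs_singleton E; rewrite /= in Ev.
move: Cj; rewrite /prop_for /continuous_at /= Ev.
by move=> Cj; exact: (cvg_trans (@near_eq_cvg _ _ (nbhs v) _ _ _ E) Cj).
Qed.

Lemma Ck1_differentiable U f : open U -> Ck 1 U f ->
  forall v, U v -> differentiable f v.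
Proof.
move=> oU [_ Df]; apply: differentiable_from_partials => // a.
  by case: (Df a).
by case: (Df a) => _ [].
Qed.

Lemma Ck2_twice_differentiable U f : open U -> Ck 2 U f ->
  twice_differentiable U f.
Proof.
move=> oU [_ Df]; split; last first.
  by move=> a; apply: Ck1_differentiable => //; case: (Df a).
apply: differentiable_from_partials => // a.
  by case: (Df a).
by case: (Df a) => _ [].
Qed.

Lemma twice_differentiable_eq U f g : open U ->
  (forall v, U v -> f v = g v) -> twice_differentiable U f ->
  twice_differentiable U g.
Proof.
move=> oU fg [df ddf].
have nfg v : U v -> {near v, f =1 g}.
  by move=> Uv; apply: filterS (open_nbhs_nbhs (conj oU Uv)) => z /fg.
split=> [v Uv|a v Uv]; first exact: near_eq_differentiable (nfg _ Uv) (df _ Uv).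
apply: near_eq_differentiable (ddf a v Uv).
apply: filterS (open_nbhs_nbhs (conj oU Uv)) => z Uz.
by apply: near_eq_derive; exact: nfg.
Qed.

Lemma twice_differentiable_sub U V f : U `<=` V ->
  twice_differentiable V f -> twice_differentiable U f.
Proof. by move=> UV [d dd]; split=> [v /UV|a v /UV]; [exact: d|exact: dd]. Qed.

(** The chain rule, with the differential of [g] expanded on the canonical
    basis. *)
Lemma partial_comp f g v a : differentiable f v -> differentiable g (f v) ->
  partial a (g \o f) v = partial a f v 0 0 *: partial 0 g (f v) +
                         partial a f v 0 1 *: partial 1 g (f v).
Proof.
move=> df dg; rewrite /partial !deriveE //; last exact: differentiable_comp.
set e := delta_mx 0 a.
have dgf : 'd (g \o f) v e = 'd g (f v) ('d f v e).
  by have /(congr1 (fun k => k e)) := diff_comp df dg.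
exact: etrans dgf (linear_row2 ('d g (f v)) ('d f v e)).
Qed.

Lemma twice_differentiable_comp U V f g : open U ->
  (forall v, U v -> V (f v)) ->
  twice_differentiable U f -> twice_differentiable V g ->
  twice_differentiable U (g \o f).
Proof.
move=> oU UV [df ddf] [dg ddg]; split.
  by move=> v Uv; apply: differentiable_comp; [exact: df|exact/dg/UV].
move=> a v Uv.
apply: (@near_eq_differentiable _ _ _
  (fun v => partial a f v 0 0 *: partial 0 g (f v) +
            partial a f v 0 1 *: partial 1 g (f v))).
  apply: filterS (open_nbhs_nbhs (conj oU Uv)) => z Uz.
  by rewrite partial_comp //; [exact: df|exact/dg/UV].
have term b : differentiable (fun z => partial a f z 0 b *: partial b g (f z)) v.
  apply: differentiable_scale.
    by apply: differentiable_coordinate; exact: ddf.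
  exact: differentiable_comp (df _ Uv) (ddg b _ (UV _ Uv)).
exact: differentiableD (term 0) (term 1).
Qed.

End TwiceDifferentiable.

(** * Charts *)

Section Charts.
Context {R : realType}.
Local Notation plane := 'rV[R]_2.

Lemma pcoordK (M : Type) (c : param R M) (m : M) : pimage c m ->
  c (pcoord c m) = m.
Proof. by move=> cm; apply: (@pinvK _ _ (fun=> 0) (pdom c) c); rewrite inE. Qed.

Lemma pcoord_dom (M : Type) (c : param R M) (m : M) : pimage c m ->
  pdom c (pcoord c m).
Proof.
move=> cm; apply: (@surjpinv_image_sub _ _ (fun=> 0) (pdom c) (pimage c) c).
  by move=> y [v cv <-]; exists v.
by exists m.
Qed.

Lemma pimage_open (M : topologicalType) (c : param R M) :
  topological_chart c -> open (pimage c).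
Proof. by move=> [oc _ _ H]; apply: H. Qed.

Lemma locdom_open (M N : topologicalType) (f : M -> N) (c : param R M)
    (c' : param R N) :
  continuous f -> topological_chart c -> topological_chart c' ->
  open (locdom f c c').
Proof.
move=> fC [oc _ cC _] /pimage_open oc'; rewrite openE => v [cv c'fv].
have n1 : nbhs v (pdom c) by exact: open_nbhs_nbhs.
have n2 : nbhs (f (c v)) (pimage c') by exact: open_nbhs_nbhs.
have n3 : nbhs v ((f \o c) @^-1` pimage c').
  have : {for v, continuous (f \o c)}.
    by apply: continuous_comp; [exact: cC|exact: fC].
  by apply; exact: n2.
by apply: filterS2 n1 n3 => z.
Qed.

(** A [C^2] map read in two [C^2] charts that need not belong to the atlases is
    locally the composite of a change of charts from [c] to an atlas chart, of
    the map read in atlas charts, and of a change of charts from an atlas chart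
    to [c']. *)
Lemma Ck_map_locrep (M N : smoothSurface R) (f : M -> N) (c : param R M)
    (c' : param R N) :
  Ck_map 2 f -> Ck_chart 2 c -> Ck_chart 2 c' ->
  twice_differentiable (locdom f c c') (locrep f c c').
Proof.
move=> [fC fCk] [tc cC] [tc' c'C].
have local v : locdom f c c' v -> exists U, [/\ open U, U v &
    twice_differentiable U (locrep f c c')].
  move=> [cv c'fv].
  have [b ab bcv] := atlas_cover (c v).
  have [b' ab' b'fcv] := atlas_cover (f (c v)).
  have tb := atlas_chart ab; have tb' := atlas_chart ab'.
  have idM : continuous (@id M) by move=> ?; exact: cvg_id.
  have idN : continuous (@id N) by move=> ?; exact: cvg_id.
  pose U := locdom id c b `&` (locdom f c b' `&` locdom f c c').
  exists U.
  have oU : open U by apply: openI; [|apply: openI]; exact: locdom_open.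
  split => //.
  have D1 := Ck2_twice_differentiable (locdom_open idM tc tb) (cC _ ab).1.
  have D2 := Ck2_twice_differentiable (locdom_open fC tb tb') (fCk _ _ ab ab').
  have D3 := Ck2_twice_differentiable (locdom_open idN tb' tc') (c'C _ ab').2.
  apply: (@twice_differentiable_eq _ _ (locrep id b' c' \o
      (locrep f b b' \o locrep id c b))) => //.
    move=> z [[_ bz] [[_ b'z] [_ c'z]]].
    by rewrite /= /locrep /= pcoordK // pcoordK.
  apply: twice_differentiable_comp D3 => //.
    move=> z [[_ bz] [[_ b'z] [_ c'z]]]; rewrite /locdom /locrep /=.
    by rewrite !pcoordK //; split => //; exact: pcoord_dom.
  apply: twice_differentiable_comp D2 => //.
    move=> z [[_ bz] [[_ b'z] [_ c'z]]]; rewrite /locdom /locrep /=.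
    by rewrite !pcoordK //; split => //; exact: pcoord_dom.
  by apply: twice_differentiable_sub D1 => z [].
by split=> [v /local[U [_ Uv [H _]]]|a v /local[U [_ Uv [_ H]]]]; exact: H.
Qed.

End Charts.

(** * The norms on the plane and on its powers *)

Section Norms.
Context {R : realType}.
Local Notation plane := 'rV[R]_2.

Lemma entry_le_enorm (v : plane) j : `|v 0 j| <= enorm v.
Proof.
rewrite -sqrtr_sqr ler_wsqrtr // (bigD1 j) //= lerDl sumr_ge0 // => i _.
exact: sqr_ge0.
Qed.

Lemma enorm_le_sum (v : plane) : enorm v <= `|v 0 0| + `|v 0 1|.
Proof.
rewrite -[leRHS]ger0_norm ?addr_ge0 // -sqrtr_sqr ler_wsqrtr //.
rewrite big_ord_recl big_ord1.
have -> : lift ord0 ord0 = 1 :> 'I_2 by exact: val_inj.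
rewrite sqrrD !real_normK ?num_real // lerD2r lerDl.
by rewrite mulrn_wge0 // mulr_ge0.
Qed.

Lemma enormZ (k : R) (v : plane) : enorm (k *: v) = `|k| * enorm v.
Proof.
rewrite /enorm -sqrtr_sqr -sqrtrM ?sqr_ge0 // mulr_sumr.
by congr Num.sqrt; apply: eq_bigr => j _; rewrite mxE exprMn.
Qed.

Section Norm0.
Variable n : nat.
Implicit Types (w : 'M[R]_(n, 2)) (N : 'M[R]_(n * 2)).

Lemma norm0_le w (r : R) : 0 <= r ->
  (norm0 w <= r) <-> (forall i, enorm (row i w) <= r).
Proof.
move=> r0; split; first by move=> /bigmax_leP[_ H] i; exact: H.
by move=> H; apply/bigmax_leP; split.
Qed.

Lemma norm0_ge0 w : 0 <= norm0 w.
Proof. exact: bigmax_ge_id. Qed.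

Lemma enorm_row_le w i : enorm (row i w) <= norm0 w.
Proof. by move: i; apply/norm0_le => //; exact: norm0_ge0. Qed.

Lemma mx_norm_le_norm0 w : `|w| <= norm0 w.
Proof.
apply/mx_norm_le; first exact: norm0_ge0.
move=> i j; apply: le_trans (enorm_row_le w i).
by have := entry_le_enorm (row i w) j; rewrite mxE.
Qed.

Lemma norm0_le_mx_norm w : norm0 w <= 2 * `|w|.
Proof.
apply/norm0_le => [|i]; first by rewrite mulr_ge0.
have := enorm_le_sum (row i w); rewrite !mxE => /le_trans; apply.
have := mx_entry_le_norm w i 0; have := mx_entry_le_norm w i 1.
by move=> h1 h0; lra.
Qed.

Lemma norm0_0 : norm0 (0 : 'M[R]_(n, 2)) = 0.
Proof.
apply/eqP; rewrite eq_le norm0_ge0 andbT.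
by have := norm0_le_mx_norm 0; rewrite normr0 mulr0.
Qed.

Lemma norm0Z (k : R) w : norm0 (k *: w) <= `|k| * norm0 w.
Proof.
apply/norm0_le => [|i]; first by rewrite mulr_ge0 // norm0_ge0.
have -> : row i (k *: w) = k *: row i w by apply/rowP => j; rewrite !mxE.
by rewrite enormZ ler_wpM2l // enorm_row_le.
Qed.

Lemma mulmx_vec_bounded N w :
  `|vec_mx (mxvec w *m N)| <= (n * 2)%:R * `|N| * `|w|.
Proof.
apply/mx_norm_le => [|i j]; first by rewrite !mulr_ge0.
rewrite !mxE (le_trans (ler_norm_sum _ _ _)) //.
have -> : (n * 2)%:R * `|N| * `|w| = \sum_(k < n * 2) `|N| * `|w|.
  by rewrite sumr_const card_ord -mulrA mulr_natl.
apply: ler_sum => k _; rewrite normrM mulrC.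
apply: ler_pM => //; first exact: mx_entry_le_norm.
by case/mxvec_indexP: k => a b; rewrite mxvecE; exact: mx_entry_le_norm.
Qed.

(** The operator norm is the supremum of a bounded nonempty set, and not the
    default value of [sup]. *)
Lemma opnorm0_has_sup N :
  has_sup [set norm0 (vec_mx (mxvec v *m N)) | v in [set v | norm0 v <= 1]].
Proof.
split.
  exists (norm0 (vec_mx (mxvec (0 : 'M[R]_(n, 2)) *m N))); exists 0 => //=.
  by rewrite norm0_0.
exists (2 * ((n * 2)%:R * `|N|)) => _ [v /= v1 <-].
apply: (le_trans (norm0_le_mx_norm _)); rewrite ler_wpM2l //.
apply: (le_trans (mulmx_vec_bounded _ _)).
rewrite ler_piMr ?mulr_ge0 //.
exact: le_trans (mx_norm_le_norm0 v) v1.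
Qed.

Lemma opnorm0_ge0 N : 0 <= opnorm0 N.
Proof.
have [[x [v v1 vx]] ub] := opnorm0_has_sup N.
apply: (@le_trans _ _ x); first by rewrite -vx norm0_ge0.
by apply: ub_le_sup => //; exists v.
Qed.

Lemma norm0_mulmx_le N w :
  norm0 (vec_mx (mxvec w *m N)) <= opnorm0 N * norm0 w.
Proof.
have [w0|wn0] := eqVneq (norm0 w) 0.
  have -> : w = 0.
    by apply/eqP; rewrite -normr_le0 -w0 mx_norm_le_norm0.
  by rewrite !linear0 mul0mx linear0 norm0_0 mulr0.
have wp : 0 < norm0 w by rewrite lt_def wn0 norm0_ge0.
pose u := (norm0 w)^-1 *: w.
have u1 : norm0 u <= 1.
  apply: (le_trans (norm0Z _ _)).
  by rewrite ger0_norm ?invr_ge0 ?norm0_ge0 // mulVf.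
have Nu : norm0 (vec_mx (mxvec u *m N)) <= opnorm0 N.
  by apply: ub_le_sup; [exact: (opnorm0_has_sup N).2|exists u].
have -> : w = norm0 w *: u by rewrite scalerA divff // scale1r.
rewrite linearZ -scalemxAl linearZ.
apply: (le_trans (norm0Z _ _)).
have -> : norm0 w *: u = w by rewrite scalerA divff // scale1r.
by rewrite ger0_norm ?norm0_ge0 // mulrC ler_wpM2r ?norm0_ge0.
Qed.

Lemma opnorm0_gt0 N : (0 < n)%N -> N \in unitmx -> 0 < opnorm0 N.
Proof.
move=> n0 Nu; rewrite lt_def opnorm0_ge0 andbT; apply/eqP => N0.
pose w : 'M[R]_(n, 2) := const_mx 1.
have := norm0_mulmx_le N (vec_mx (mxvec w *m invmx N)).
rewrite N0 mul0r vec_mxK mulmxKV // mxvecK.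
move=> /(le_trans (mx_norm_le_norm0 _))/(le_trans (mx_entry_le_norm w (Ordinal n0) 0)).
by rewrite mxE normr1 ler10.
Qed.

End Norm0.
End Norms.

(** * Linearization error *)

Section SecondOrderBound.
Context {R : realType}.
Local Notation plane := 'rV[R]_2.

(** The inverse of the extended reals maps 0 to [+oo] and [+oo] to 0. The strict
    inequality therefore excludes unbounded second derivatives and is automatic
    when they vanish. *)
Lemma D2norm_bound (U : set plane) (g : plane -> plane) (r k : R) :
  U !=set0 -> 0 < r -> 0 < k ->
  (r%:E < (k^-1)%:E * (16%:E * D2norm U g)^-1)%E ->
  exists C : R, [/\ 0 <= C,
    (forall v c a b, U v -> `|hessian g c v a b| <= C) & 16 * k * r * C < 1].
Proof.
move=> [v0 Uv0] r0 k0 H.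
have entry v c a b : U v -> (`|hessian g c v a b|%:E <= D2norm U g)%E.
  move=> Uv; apply: (@le_trans _ _ (\big[Num.max/0]_(c < 2)
     \big[Num.max/0]_(a < 2) \big[Num.max/0]_(b < 2) `|hessian g c v a b|)%:E).
    rewrite lee_fin; apply: le_trans (le_bigmax _ _ c).
    by apply: le_trans (le_bigmax _ _ a); exact: le_bigmax.
  by apply: ereal_sup_ubound; exists v.
have D0 : (0 <= D2norm U g)%E.
  by apply: le_trans (entry v0 0 0 0 Uv0); rewrite lee_fin.
move: H D0 entry; case: (D2norm U g) => [C| |] //.
- rewrite -EFinM inver lee_fin => H C0 entry; exists C; split => //.
  move: H; case: ifPn => [|C16 H].
    by rewrite mulf_eq0 pnatr_eq0 /= => /eqP-> _; rewrite mulr0.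
  move: H; rewrite -EFinM lte_fin -invfM.
  have Cp : 0 < C by rewrite lt_def C0 andbT; move: C16; rewrite mulf_eq0 pnatr_eq0.
  rewrite -div1r ltr_pdivlMr ?mulr_gt0 //.
  by have -> : r * (k * (16 * C)) = 16 * k * r * C by ring.
- rewrite gt0_muley ?lte_fin // mulr0 => /lt_trans/(_ r0).
  by rewrite ltxx.
Qed.

(** Unlike [mxE], which attempts to unfold derivatives applied to indices, this
    rule is cheap when [A] and [B] are derivatives. *)
Lemma entryB (A B : plane) j : (A - B) 0 j = A 0 j - B 0 j.
Proof. by rewrite !mxE. Qed.

(** The condition [2 * rho < r] places the box of radius [rho] inside the
    Euclidean ball of radius [r]. *)
Lemma linearization_error_le (U : set plane) (g : plane -> plane)
    (r rho C : R) (u v : plane) :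
  open U -> eball r `<=` U -> twice_differentiable U g -> 2 * rho < r ->
  (forall z c a b, eball r z -> `|hessian g c z a b| <= C) ->
  `|u| <= rho -> `|v| <= rho ->
  enorm ((g v - 'd g (0 : plane) v) - (g u - 'd g (0 : plane) u))
    <= 8 * C * rho * `|v - u|.
Proof.
move=> oU rU [dg ddg] rho_r HC urho vrho.
have rho0 : 0 <= rho := le_trans (normr_ge0 _) urho.
have boxr (z : plane) : `|z - 0| <= rho -> eball r z.
  rewrite subr0 => zr; rewrite /eball /=.
  apply: (le_lt_trans (enorm_le_sum z)); apply: le_lt_trans rho_r.
  have := mx_entry_le_norm z 0 0; have := mx_entry_le_norm z 0 1.
  by move=> h1 h0; lra.
have U0 : U 0 by apply/rU/boxr; rewrite subrr normr0.
have C0 : 0 <= C.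
  by apply: le_trans (HC 0 0 0 0 _) => //; apply: boxr; rewrite subrr normr0.
have nearU z : U z -> nbhs z U by move=> Uz; exact: open_nbhs_nbhs.
(* mean value inequality for the partial derivatives, from the origin *)
have partial_near c a (z : plane) : `|z - 0| <= rho ->
    `|partial a g z 0 c - partial a g 0 0 c| <= C * (2 * rho).
  move=> zr.
  have := @box_increment_le R (fun w => partial a g w 0 c) 0 0 z rho C.
  rewrite subrr normr0 => /(_ rho0 zr) H.
  apply: (@le_trans _ _ (C * (`|z 0 0 - 0| + `|z 0 1 - 0|))).
    have := H; rewrite !mxE; apply => w wr b.
    have Uw : U w by apply/rU/boxr.
    split.
      exact/diff_derivable/differentiable_coordinate/ddg.
    have := HC w c b a (boxr _ wr); rewrite mxE; congr (`|_| <= _).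
    apply: near_eq_derive; apply: filterS (nearU _ Uw) => y Uy.
    by rewrite derive_coordinate //; exact/diff_derivable/dg.
  rewrite !subr0 in zr *; rewrite ler_wpM2l //.
  have := mx_entry_le_norm z 0 0; have := mx_entry_le_norm z 0 1.
  by move=> h1 h0; lra.
pose L : plane -> plane := 'd g (0 : plane).
have Lc : continuous L by apply: diff_continuous; exact: dg.
have dL z : differentiable L z by exact: linear_differentiable.
have DL z a : 'D_(delta_mx 0 a) L z = partial a g 0.
  rewrite deriveE; last exact: dL.
  rewrite [in LHS]/L diff_lin // /partial deriveE //; exact: dg.
rewrite -/L.
have coord c : `|(g v - L v) 0 c - (g u - L u) 0 c|
    <= C * (2 * rho) * (`|v 0 0 - u 0 0| + `|v 0 1 - u 0 1|).
  apply: (@box_increment_le R (fun w => (g w - L w) 0 c) 0 u v rho);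
    rewrite ?subr0 // => z zr a.
  have Uz : U z by apply/rU/boxr.
  have Dz : derivable g z (delta_mx 0 a) by apply/diff_derivable/dg.
  have DLz : derivable L z (delta_mx 0 a) by exact/diff_derivable/dL.
  have Dd := derivableB Dz DLz.
  split; first by have /derivable_mxP := Dd; exact.
  rewrite (@derive_coordinate _ (g - L) z (delta_mx 0 a) c Dd).
  have -> : 'D_(delta_mx 0 a) (g - L) z = partial a g z - partial a g 0.
    by rewrite -(DL z a); exact: deriveB Dz DLz.
  by rewrite entryB; exact: partial_near.
apply: (le_trans (enorm_le_sum _)).
have c0 := coord 0; have c1 := coord 1.
have h0 := mx_entry_le_norm (v - u) 0 0; have h1 := mx_entry_le_norm (v - u) 0 1.
rewrite !entryB in c0 c1 h0 h1 *.
have Cr : 0 <= C * (2 * rho) by rewrite !mulr_ge0.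
have : C * (2 * rho) * (`|v 0 0 - u 0 0| + `|v 0 1 - u 0 1|) <=
    C * (2 * rho) * (2 * `|v - u|) by rewrite ler_wpM2l //; lra.
move=> T; apply: (le_trans (lerD c0 c1)).
have -> : 8 * C * rho * `|v - u| =
  C * (2 * rho) * (2 * `|v - u|) + C * (2 * rho) * (2 * `|v - u|) by ring.
exact: lerD.
Qed.

End SecondOrderBound.

(** * The Newton map *)

Section Newton.
Context {R : realType}.
Local Notation plane := 'rV[R]_2.

(* joins the complete and the normed structures of matrices *)
HB.instance Definition _ (m n : nat) := Complete.on 'M[R]_(m, n).

Lemma contraction_fixed_point (V : completeNormedModType R) (G : V -> V)
    (rho q : R) : 0 < rho -> 0 <= q < 1 ->
  (forall u, `|u| <= rho -> `|G u| <= rho) ->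
  (forall u v, `|u| <= rho -> `|v| <= rho -> `|G u - G v| <= q * `|u - v|) ->
  exists2 w, `|w| <= rho & w = G w.
Proof.
move=> rho0 /andP[q0 q1] GU Gq.
pose U := [set w : V | `|w| <= rho].
have GUU : set_fun U U G by move=> u; exact: GU.
have clU : closed U.
  have -> : U = closed_ball 0 rho.
    rewrite closed_ballE // /closed_ball_; apply/seteqP.
    by split=> w /=; rewrite sub0r normrN.
  exact: closed_ball_closed.
have [||w] := @banach_fixed_point R V U (mkfun GUU) _ clU.
- exists (NngNum q0); split => //= -[u v] /= [Uu Uv]; exact: Gq.
- by exists 0; rewrite /U /= normr0 ltW.
- by exists w.
Qed.

Lemma cyclic_map_linear n (l : 'I_n -> {linear plane -> plane}) :
  linear (cyclic_map (fun i => l i)).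
Proof.
move=> k u v; apply/row_matrixP => i.
by rewrite linearP /= !rowK !linearP.
Qed.

Lemma mul_cyclic_mx n (l : 'I_n -> {linear plane -> plane}) (w : 'M[R]_(n, 2)) :
  mxvec w *m lin_mx (cyclic_map (fun i => l i)) =
  mxvec (cyclic_map (fun i => l i) w).
Proof.
pose lM := GRing.isLinear.Build _ _ _ _ _ (cyclic_map_linear l).
pose lL : {linear 'M[R]_(n, 2) -> 'M[R]_(n, 2)} :=
  HB.pack (cyclic_map (fun i => l i)) lM.
exact: (mul_vec_lin lL).
Qed.

(** The fixed points of [cyclic_map g] are those of the map [G] that sends [w]
    to the image of [cyclic_map l w - cyclic_map g w] by the inverse of [N]. The
    norm of this inverse turns the Lipschitz constant [(12 * kappa)^-1] of the
    errors [g i - l i] into the contraction factor [12^-1]. *)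
Lemma cyclic_fixed_point n (g : 'I_n -> plane -> plane)
    (l : 'I_n -> {linear plane -> plane}) (delta : R) :
  let N := lin_mx (cyclic_map (fun i => l i)) - 1%:M in
  let kappa := opnorm0 (invmx N) in
  N \in unitmx -> 0 < kappa -> 0 < delta ->
  (forall i u v, `|u| <= 2 * kappa * delta -> `|v| <= 2 * kappa * delta ->
    enorm ((g i v - l i v) - (g i u - l i u)) <= (12 * kappa)^-1 * `|v - u|) ->
  (forall i, enorm (g i 0) <= delta) ->
  exists w, cyclic_map g w = w /\ `|w| <= 2 * kappa * delta.
Proof.
move=> N kappa Nu kp dp gl g0; set rho := 2 * kappa * delta in gl *.
have rho0 : 0 < rho by rewrite !mulr_gt0.
pose A := cyclic_map (fun i => l i).
pose E w := A w - cyclic_map g w.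
pose G w := vec_mx (mxvec (E w) *m invmx N).
(* G u - G v only involves the errors g i - l i *)
have GB u v : G u - G v = vec_mx (mxvec (E u - E v) *m invmx N).
  by rewrite /G -linearB -mulmxBl -linearB.
have Glip u v : `|u| <= rho -> `|v| <= rho -> `|G u - G v| <= 12^-1 * `|u - v|.
  move=> ur vr; apply: (le_trans (mx_norm_le_norm0 _)).
  rewrite GB; apply: (le_trans (norm0_mulmx_le _ _)); rewrite -/kappa.
  have -> : 12^-1 * `|u - v| = kappa * ((12 * kappa)^-1 * `|u - v|).
    by rewrite invfM; field; rewrite gt_eqF.
  rewrite ler_wpM2l ?(ltW kp) //; apply/norm0_le.
    by rewrite mulr_ge0 // invr_ge0 mulr_ge0 // ltW.
  have rowle (w : 'M[R]_(n, 2)) j : `|row j w| <= `|w|.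
    by apply/mx_norm_le => // a b; rewrite mxE; exact: mx_entry_le_norm.
  move=> i; set j := ord_pred i.
  have -> : row i (E u - E v) = (g j (row j v) - l j (row j v))
                              - (g j (row j u) - l j (row j u)).
    have rowE w : row i (E w) = l j (row j w) - g j (row j w).
      by rewrite /E (linearB (row i)) /= !rowK.
    by rewrite (linearB (row i)) /= !rowE !opprB addrC.
  apply: (le_trans (gl _ _ _ (le_trans (rowle _ _) ur) (le_trans (rowle _ _) vr))).
  rewrite ler_wpM2l ?invr_ge0 ?mulr_ge0 ?(ltW kp) // distrC.
  by rewrite -(linearB (row j)); exact: rowle.
have G0 : `|G 0| <= kappa * delta.
  apply: (le_trans (mx_norm_le_norm0 _)); apply: (le_trans (norm0_mulmx_le _ _)).
  rewrite -/kappa ler_wpM2l ?(ltW kp) //.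
  apply/norm0_le => [|i]; first exact: ltW.
  rewrite linearB /= !rowK !row0 linear0 sub0r -scaleN1r enormZ.
  by rewrite normrN1 mul1r.
have GU u : `|u| <= rho -> `|G u| <= rho.
  move=> ur; have := Glip u 0 ur; rewrite normr0 subr0 => /(_ (ltW rho0)) h.
  have -> : G u = (G u - G 0) + G 0 by rewrite subrK.
  apply: (le_trans (ler_normD _ _)).
  have kd : 0 < kappa * delta by rewrite mulr_gt0.
  rewrite /rho in ur *; lra.
have [w wr wG] := @contraction_fixed_point _ G rho 12^-1 rho0
  ltac:(by apply/andP; split; lra) GU Glip.
exists w; split => //.
have /(congr1 mxvec) := wG; rewrite vec_mxK => /(congr1 (mulmx^~ N)).
rewrite mulmxKV // mulmxBr mulmx1 mul_cyclic_mx -/A linearB.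
by move=> /addrI/oppr_inj/(can_inj mxvecK).
Qed.

End Newton.

(** * Periodic points *)

Lemma iter_ordS (n : nat) (n_gt0 : (0 < n)%N) (k : nat) :
  iter k (@ordS n) (Ordinal n_gt0) = (k %% n)%N :> nat.
Proof.
elim: k => [|k IHk]; first by rewrite mod0n.
by rewrite iterS /= IHk -addn1 modnDml addn1.
Qed.

Theorem lemma3p2 (R : realType) (M : smoothSurface R) (h : M -> M)
    (n : nat) (x : 'I_n -> M) (phi : 'I_n -> param R M)
    (n_gt0 : (0 < n)%N)
    (h_diffeo : Ck_diffeo 2 h)
    (phi_chart : forall i, Ck_chart 2 (phi i))
    (phi_dom0 : forall i, pdom (phi i) 0)
    (phi0 : forall i, x i = phi i 0)
    (hx : forall i, pimage (phi (ordS i)) (h (x i))) :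
  let U := fun i => locdom h (phi i) (phi (ordS i)) in
  let hc := fun i => locrep h (phi i) (phi (ordS i)) in
  let L : 'M[R]_(n * 2) :=
    lin_mx (cyclic_map (fun i => 'd (hc i) (0 : 'rV[R]_2))) in
  L - 1%:M \in unitmx ->
  let kappa := opnorm0 (invmx (L - 1%:M)) in
  forall (delta : R) (delta_gt0 : 0 < delta)
    (hU : forall i, eball (12 * kappa * delta) `<=` U i)
    (hD2 : forall i, ((12 * kappa * delta)%:E <
       (kappa^-1)%:E * (16%:E * D2norm (eball (12 * kappa * delta)) (hc i))^-1)%E)
    (hsmall : forall i, enorm (hc i 0) < delta),
  exists p : M,
    iter n h p = p /\
    forall i : 'I_n, (phi i @` eball (6 * kappa * delta)) (iter i h p).
Proof.
move=> U hc L Lu kappa delta delta0 hU hD2 hsmall.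
have kappa0 : 0 < kappa by apply: opnorm0_gt0 => //; rewrite unitmx_inv.
have kd0 : 0 < kappa * delta by rewrite mulr_gt0.
set r := 12 * kappa * delta in hU hD2.
have r0 : 0 < r by rewrite !mulr_gt0.
have h_map : Ck_map 2 h by case: h_diffeo => ? [].
have hc_diff i : twice_differentiable (U i) (hc i).
  by apply: Ck_map_locrep.
have U_open i : open (U i).
  by apply: locdom_open; [case: h_map|case: (phi_chart i)|case: (phi_chart (ordS i))].
have error i u v : `|u| <= 2 * kappa * delta -> `|v| <= 2 * kappa * delta ->
    enorm ((hc i v - 'd (hc i) (0 : 'rV[R]_2) v)
         - (hc i u - 'd (hc i) (0 : 'rV[R]_2) u))
    <= (12 * kappa)^-1 * `|v - u|.
  move=> ur vr.
  have ball0 : eball r !=set0.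
    exists 0; apply: (le_lt_trans (enorm_le_sum _)).
    by rewrite !mxE normr0 addr0.
  have [C [C0 HC Cr]] := D2norm_bound ball0 r0 kappa0 (hD2 i).
  have rho_r : 2 * (2 * kappa * delta) < r by rewrite /r; lra.
  apply: (le_trans (linearization_error_le (U_open i) (@hU i) (hc_diff i)
    rho_r _ ur vr)); first by move=> z c a b; exact: HC.
  rewrite ler_wpM2r // -[leRHS]mul1r ler_pdivlMr ?mulr_gt0 //.
  by rewrite /r in Cr; lra.
have [w [w_fix w_le]] := @cyclic_fixed_point R n hc (fun i => 'd (hc i) 0) delta
  Lu kappa0 delta0 error (fun i => ltW (hsmall i)).
rewrite -/L -/kappa in w_le.
have row_ball i : enorm (row i w) < 6 * kappa * delta.
  apply: (le_lt_trans (enorm_row_le w i)); apply: (le_lt_trans (norm0_le_mx_norm w)).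
  by lra.
(* y i is the i-th point of the orbit, and h maps it to the next one *)
pose y i := phi i (row i w).
have hy i : h (y i) = y (ordS i).
  have Uw : U i (row i w) by apply: hU; apply: (lt_trans (row_ball i)); rewrite /r; lra.
  have -> : y (ordS i) = phi (ordS i) (hc i (row i w)).
    by rewrite /y -[in LHS]w_fix rowK ordSK.
  by rewrite /hc /locrep pcoordK //; case: Uw.
pose i0 := Ordinal n_gt0.
have iter_y k : iter k h (y i0) = y (iter k (@ordS n) i0).
  by elim: k => //= k ->; rewrite hy.
exists (y i0); split.
  rewrite iter_y; congr y; apply: val_inj.
  by rewrite /= iter_ordS modnn.
move=> i; exists (row i w); first exact: row_ball.
rewrite iter_y; congr y; apply: val_inj.
by rewrite /= iter_ordS modn_small.
Qed.
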